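(* $\mathbf{CZF}$ with the addition of the law of excluded middle is impredicative, in the sense that classical second-order arithmetic $\mathbf{PA}^2$ can be interpreted in it.
   Context: $\mathbf{CZF}$ (Aczel's constructive set theory) is the theory in the language of set theory, over intuitionistic logic, with axioms extensionality, pairing, union, separation restricted to $\Delta_0$-formulas, infinity, $\in$-induction, strong collection and subset collection. The law of excluded middle is the scheme $\phi\lor\neg\phi$ for all formulas $\phi$. $\mathbf{PA}^2$ is classical second-order arithmetic: the language of $\mathbf{PA}$ with a second sort of variables $X,Y,\dots$ for sets of natural numbers and atomic formulas $t\in X$, with the second-order induction axiom and the full comprehension scheme. Equivalently, it can be formulated with set variables read as characteristic functions of type $\mathbf{N}\to\mathbf{N}$ and $t\in X$ read as $X(t)=1$, comprehension being $\exists f^{\mathbf{N}\to\mathbf{N}}\forall x^{\mathbf{N}}(fx=1\Leftrightarrow\phi(x))$ for arbitrary $\phi$ in which $f$ is not free. *)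

(* Defs.v *)
From Stdlib Require Import List.
Import ListNotations.

(* Formulas are in de Bruijn style: index 0 is the variable of the innermost
   enclosing quantifier. *)

Definition scons {X : Type} (x : X) (f : nat -> X) (n : nat) : X :=
  match n with 0 => x | S n => f n end.

Notation "x .: f" := (scons x f) (at level 55, right associativity).

Inductive sform : Type :=
| SBot : sform
| SEq  : nat -> nat -> sform
| SMem : nat -> nat -> sform
| SAnd : sform -> sform -> sform
| SOr  : sform -> sform -> sform
| SImp : sform -> sform -> sform
| SAll : sform -> sform
| SEx  : sform -> sform.

Declare Scope set_form_scope.
Delimit Scope set_form_scope with sf.
Bind Scope set_form_scope with sform.
Notation "⊥" := SBot : set_form_scope.
Notation "x ≡ y" := (SEq x y) (at level 70) : set_form_scope.
Notation "x ∈ y" := (SMem x y) (at level 70) : set_form_scope.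
Notation "¬ A" := (SImp A SBot) (at level 75, right associativity) : set_form_scope.
Notation "A ∧ B" := (SAnd A B) (at level 80, right associativity) : set_form_scope.
Notation "A ∨ B" := (SOr A B) (at level 85, right associativity) : set_form_scope.
Notation "A → B" := (SImp A B) (at level 90, right associativity) : set_form_scope.
Notation "A ↔ B" := (SAnd (SImp A B) (SImp B A)) (at level 95, no associativity)
  : set_form_scope.

(* Bounded quantifiers; the index [y] is read outside the new binder. *)
Definition SAllIn (y : nat) (A : sform) : sform := SAll (0 ∈ S y → A)%sf.
Definition SExIn (y : nat) (A : sform) : sform := SEx (0 ∈ S y ∧ A)%sf.

(* The only terms are variables, so substitution is renaming. *)
Fixpoint sren (r : nat -> nat) (A : sform) : sform :=
  match A with
  | SBot => SBot
  | SEq x y => SEq (r x) (r y)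
  | SMem x y => SMem (r x) (r y)
  | SAnd A B => SAnd (sren r A) (sren r B)
  | SOr A B => SOr (sren r A) (sren r B)
  | SImp A B => SImp (sren r A) (sren r B)
  | SAll A => SAll (sren (0 .: fun n => S (r n)) A)
  | SEx A => SEx (sren (0 .: fun n => S (r n)) A)
  end.

Definition sinst (A : sform) (x : nat) : sform := sren (x .: fun n => n) A.

(* All free variables of [A] are among the indices [0, ..., k - 1]. *)
Fixpoint sclosed (k : nat) (A : sform) : Prop :=
  match A with
  | SBot => True
  | SEq x y | SMem x y => x < k /\ y < k
  | SAnd A B | SOr A B | SImp A B => sclosed k A /\ sclosed k B
  | SAll A | SEx A => sclosed (S k) A
  end.

(* Intuitionistic natural deduction with equality.  [T] is the set of
   nonlogical axioms; since (All-I) puts no condition on [T], an open formula of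
   [T] has the force of its universal closure. *)
Inductive sprv (T : sform -> Prop) : list sform -> sform -> Prop :=
| s_hyp G A : In A G -> sprv T G A
| s_ax G A : T A -> sprv T G A
| s_botE G A : sprv T G SBot -> sprv T G A
| s_andI G A B : sprv T G A -> sprv T G B -> sprv T G (SAnd A B)
| s_andE1 G A B : sprv T G (SAnd A B) -> sprv T G A
| s_andE2 G A B : sprv T G (SAnd A B) -> sprv T G B
| s_orI1 G A B : sprv T G A -> sprv T G (SOr A B)
| s_orI2 G A B : sprv T G B -> sprv T G (SOr A B)
| s_orE G A B C :
    sprv T G (SOr A B) -> sprv T (A :: G) C -> sprv T (B :: G) C -> sprv T G C
| s_impI G A B : sprv T (A :: G) B -> sprv T G (SImp A B)
| s_impE G A B : sprv T G (SImp A B) -> sprv T G A -> sprv T G B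
| s_allI G A : sprv T (map (sren S) G) A -> sprv T G (SAll A)
| s_allE G A x : sprv T G (SAll A) -> sprv T G (sinst A x)
| s_exI G A x : sprv T G (sinst A x) -> sprv T G (SEx A)
| s_exE G A C :
    sprv T G (SEx A) -> sprv T (A :: map (sren S) G) (sren S C) -> sprv T G C
| s_refl G x : sprv T G (SEq x x)
| s_leibniz G A x y :
    sprv T G (SEq x y) -> sprv T G (sinst A x) -> sprv T G (sinst A y).

Inductive Delta0 : sform -> Prop :=
| D0_bot : Delta0 SBot
| D0_eq x y : Delta0 (SEq x y)
| D0_mem x y : Delta0 (SMem x y)
| D0_and A B : Delta0 A -> Delta0 B -> Delta0 (SAnd A B)
| D0_or A B : Delta0 A -> Delta0 B -> Delta0 (SOr A B)
| D0_imp A B : Delta0 A -> Delta0 B -> Delta0 (SImp A B)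
| D0_all y A : Delta0 A -> Delta0 (SAllIn y A)
| D0_ex y A : Delta0 A -> Delta0 (SExIn y A).

Section SetTheory.
Local Open Scope set_form_scope.

(* ∀a ∀b (∀z (z ∈ a ↔ z ∈ b) → a = b) *)
Definition ax_ext : sform := SAll (SAll (SAll (0 ∈ 2 ↔ 0 ∈ 1) → 1 ≡ 0)).

(* ∀a ∀b ∃c ∀x (x ∈ c ↔ x = a ∨ x = b) *)
Definition ax_pair : sform :=
  SAll (SAll (SEx (SAll (0 ∈ 1 ↔ 0 ≡ 3 ∨ 0 ≡ 2)))).

(* ∀a ∃c ∀x (x ∈ c ↔ ∃z ∈ a. x ∈ z) *)
Definition ax_union : sform :=
  SAll (SEx (SAll (0 ∈ 1 ↔ SExIn 2 (1 ∈ 0)))).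

(* ∀a ∃c ∀x (x ∈ c ↔ x ∈ a ∧ A), with A = A(x, a, parameters) *)
Definition ax_sep (A : sform) : sform :=
  SAll (SEx (SAll (0 ∈ 1 ↔ 0 ∈ 2 ∧ sren (0 .: fun n => 2 + n) A))).

(* ∃w (∃u ∈ w. ∀z (z ∉ u)  ∧  ∀u ∈ w. ∃v ∈ w. ∀z (z ∈ v ↔ z ∈ u ∨ z = u)) *)
Definition ax_inf : sform :=
  SEx (SExIn 0 (SAll (¬ 0 ∈ 1))
       ∧ SAllIn 0 (SExIn 1 (SAll (0 ∈ 1 ↔ 0 ∈ 2 ∨ 0 ≡ 2)))).

(* ∀x (∀y ∈ x. A(y) → A(x)) → ∀x A(x), with A = A(x, parameters) *)
Definition ax_ind (A : sform) : sform :=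
  SAll (SAllIn 0 (sren (0 .: fun n => 2 + n) A) → A) → SAll A.

(* ∀a (∀x ∈ a. ∃y A  →  ∃b (∀x ∈ a. ∃y ∈ b. A  ∧  ∀y ∈ b. ∃x ∈ a. A)),
   with A = A(y, x, a, parameters) *)
Definition ax_scoll (A : sform) : sform :=
  SAll (SAllIn 0 (SEx A) →
        SEx (SAllIn 1 (SExIn 1 (sren (0 .: 1 .: fun n => 3 + n) A))
             ∧ SAllIn 0 (SExIn 2 (sren (1 .: 0 .: fun n => 3 + n) A)))).

(* ∀a ∀b ∃c ∀u (∀x ∈ a. ∃y ∈ b. A  →
                ∃d ∈ c. (∀x ∈ a. ∃y ∈ d. A  ∧  ∀y ∈ d. ∃x ∈ a. A)),
   with A = A(y, x, u, b, a, parameters) *)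
Definition ax_subcoll (A : sform) : sform :=
  SAll (SAll (SEx (SAll
    (SAllIn 3 (SExIn 3 (sren (0 .: 1 .: 2 .: fun n => 4 + n) A)) →
     SExIn 1
       (SAllIn 4 (SExIn 1 (sren (0 .: 1 .: 3 .: fun n => 5 + n) A))
        ∧ SAllIn 0 (SExIn 5 (sren (1 .: 0 .: 3 .: fun n => 5 + n) A))))))).

End SetTheory.

Inductive CZF : sform -> Prop :=
| CZF_ext : CZF ax_ext
| CZF_pair : CZF ax_pair
| CZF_union : CZF ax_union
| CZF_sep A : Delta0 A -> CZF (ax_sep A)
| CZF_inf : CZF ax_inf
| CZF_set_induction A : CZF (ax_ind A)
| CZF_scoll A : CZF (ax_scoll A)
| CZF_subcoll A : CZF (ax_subcoll A).

Inductive LEM : sform -> Prop :=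
| LEM_intro A : LEM (A ∨ ¬ A)%sf.

Definition CZF_LEM (A : sform) : Prop := CZF A \/ LEM A.

(* Number variables and set variables have independent de Bruijn indices. *)
Inductive term : Type :=
| tvar  : nat -> term
| tzero : term
| tsucc : term -> term
| tadd  : term -> term -> term
| tmul  : term -> term -> term.

Inductive aform : Type :=
| ABot  : aform
| AEq   : term -> term -> aform
| AMem  : term -> nat -> aform
| AAnd  : aform -> aform -> aform
| AOr   : aform -> aform -> aform
| AImp  : aform -> aform -> aform
| AAll1 : aform -> aform
| AEx1  : aform -> aform
| AAll2 : aform -> aform
| AEx2  : aform -> aform.

Declare Scope arith_form_scope.
Delimit Scope arith_form_scope with af.
Bind Scope arith_form_scope with aform.
Notation "⊥" := ABot : arith_form_scope.
Notation "s ≡ t" := (AEq s t) (at level 70) : arith_form_scope.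
Notation "t ∈ X" := (AMem t X) (at level 70) : arith_form_scope.
Notation "¬ A" := (AImp A ABot) (at level 75, right associativity) : arith_form_scope.
Notation "A ∧ B" := (AAnd A B) (at level 80, right associativity) : arith_form_scope.
Notation "A ∨ B" := (AOr A B) (at level 85, right associativity) : arith_form_scope.
Notation "A → B" := (AImp A B) (at level 90, right associativity) : arith_form_scope.
Notation "A ↔ B" := (AAnd (AImp A B) (AImp B A)) (at level 95, no associativity)
  : arith_form_scope.

Fixpoint tsub (s : nat -> term) (t : term) : term :=
  match t with
  | tvar n => s n
  | tzero => tzero
  | tsucc t => tsucc (tsub s t)
  | tadd t u => tadd (tsub s t) (tsub s u)
  | tmul t u => tmul (tsub s t) (tsub s u)
  end.

Definition tshift (t : term) : term := tsub (fun n => tvar (S n)) t.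

(* [s] substitutes for number variables, [r] renames set variables. *)
Fixpoint asub (s : nat -> term) (r : nat -> nat) (A : aform) : aform :=
  match A with
  | ABot => ABot
  | AEq t u => AEq (tsub s t) (tsub s u)
  | AMem t X => AMem (tsub s t) (r X)
  | AAnd A B => AAnd (asub s r A) (asub s r B)
  | AOr A B => AOr (asub s r A) (asub s r B)
  | AImp A B => AImp (asub s r A) (asub s r B)
  | AAll1 A => AAll1 (asub (tvar 0 .: fun n => tshift (s n)) r A)
  | AEx1 A => AEx1 (asub (tvar 0 .: fun n => tshift (s n)) r A)
  | AAll2 A => AAll2 (asub s (0 .: fun n => S (r n)) A)
  | AEx2 A => AEx2 (asub s (0 .: fun n => S (r n)) A)
  end.

Definition ashift1 : aform -> aform := asub (fun n => tvar (S n)) (fun X => X).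
Definition ashift2 : aform -> aform := asub tvar S.
Definition ainst1 (A : aform) (t : term) : aform := asub (t .: tvar) (fun X => X) A.
Definition ainst2 (A : aform) (X : nat) : aform := asub tvar (X .: fun Y => Y) A.

Fixpoint tclosed (k : nat) (t : term) : Prop :=
  match t with
  | tvar n => n < k
  | tzero => True
  | tsucc t => tclosed k t
  | tadd t u | tmul t u => tclosed k t /\ tclosed k u
  end.

(* At most the first [k] number variables and [l] set variables occur free. *)
Fixpoint aclosed (k l : nat) (A : aform) : Prop :=
  match A with
  | ABot => True
  | AEq t u => tclosed k t /\ tclosed k u
  | AMem t X => tclosed k t /\ X < l
  | AAnd A B | AOr A B | AImp A B => aclosed k l A /\ aclosed k l B
  | AAll1 A | AEx1 A => aclosed (S k) l A
  | AAll2 A | AEx2 A => aclosed k (S l) A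
  end.

Definition sentence (A : aform) : Prop := aclosed 0 0 A.

(* Classical two-sorted natural deduction with equality on numbers; open
   formulas of [T] again have the force of their universal closures. *)
Inductive aprv (T : aform -> Prop) : list aform -> aform -> Prop :=
| a_hyp G A : In A G -> aprv T G A
| a_ax G A : T A -> aprv T G A
| a_dne G A : aprv T G (¬ ¬ A)%af -> aprv T G A
| a_botE G A : aprv T G ABot -> aprv T G A
| a_andI G A B : aprv T G A -> aprv T G B -> aprv T G (AAnd A B)
| a_andE1 G A B : aprv T G (AAnd A B) -> aprv T G A
| a_andE2 G A B : aprv T G (AAnd A B) -> aprv T G B
| a_orI1 G A B : aprv T G A -> aprv T G (AOr A B)
| a_orI2 G A B : aprv T G B -> aprv T G (AOr A B)
| a_orE G A B C :
    aprv T G (AOr A B) -> aprv T (A :: G) C -> aprv T (B :: G) C -> aprv T G C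
| a_impI G A B : aprv T (A :: G) B -> aprv T G (AImp A B)
| a_impE G A B : aprv T G (AImp A B) -> aprv T G A -> aprv T G B
| a_all1I G A : aprv T (map ashift1 G) A -> aprv T G (AAll1 A)
| a_all1E G A t : aprv T G (AAll1 A) -> aprv T G (ainst1 A t)
| a_ex1I G A t : aprv T G (ainst1 A t) -> aprv T G (AEx1 A)
| a_ex1E G A C :
    aprv T G (AEx1 A) -> aprv T (A :: map ashift1 G) (ashift1 C) -> aprv T G C
| a_all2I G A : aprv T (map ashift2 G) A -> aprv T G (AAll2 A)
| a_all2E G A X : aprv T G (AAll2 A) -> aprv T G (ainst2 A X)
| a_ex2I G A X : aprv T G (ainst2 A X) -> aprv T G (AEx2 A)
| a_ex2E G A C :
    aprv T G (AEx2 A) -> aprv T (A :: map ashift2 G) (ashift2 C) -> aprv T G C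
| a_refl G t : aprv T G (AEq t t)
| a_leibniz G A t u :
    aprv T G (AEq t u) -> aprv T G (ainst1 A t) -> aprv T G (ainst1 A u).

Inductive PA2 : aform -> Prop :=
| PA2_succ_neq_zero : PA2 (AAll1 (¬ tsucc (tvar 0) ≡ tzero))
| PA2_succ_inj :
    PA2 (AAll1 (AAll1 (tsucc (tvar 1) ≡ tsucc (tvar 0) → tvar 1 ≡ tvar 0)))
| PA2_add_zero : PA2 (AAll1 (tadd (tvar 0) tzero ≡ tvar 0))
| PA2_add_succ :
    PA2 (AAll1 (AAll1
      (tadd (tvar 1) (tsucc (tvar 0)) ≡ tsucc (tadd (tvar 1) (tvar 0)))))
| PA2_mul_zero : PA2 (AAll1 (tmul (tvar 0) tzero ≡ tzero))
| PA2_mul_succ :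
    PA2 (AAll1 (AAll1
      (tmul (tvar 1) (tsucc (tvar 0)) ≡ tadd (tmul (tvar 1) (tvar 0)) (tvar 1))))
| PA2_induction :
    PA2 (AAll2 (tzero ∈ 0 ∧ AAll1 (tvar 0 ∈ 0 → tsucc (tvar 0) ∈ 0) →
                AAll1 (tvar 0 ∈ 0)))
(* ∃X ∀x (x ∈ X ↔ A(x)), for an arbitrary A not containing X *)
| PA2_comp A : PA2 (AEx2 (AAll1 (tvar 0 ∈ 0 ↔ ashift2 A))).

(* Parameter-free relative interpretations: each sort is sent to a definable
   class, equality to equality, and each function symbol to the graph of a
   definable function, with the arguments at the first indices and the value at
   the last one. *)
Record interpretation : Type := Interpretation {
  i_num : sform;
  i_set : sform;
  i_zero : sform;
  i_succ : sform;
  i_add : sform;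
  i_mul : sform;
  i_mem : sform;
  i_num_closed : sclosed 1 i_num;
  i_set_closed : sclosed 1 i_set;
  i_zero_closed : sclosed 1 i_zero;
  i_succ_closed : sclosed 2 i_succ;
  i_add_closed : sclosed 3 i_add;
  i_mul_closed : sclosed 3 i_mul;
  i_mem_closed : sclosed 2 i_mem
}.

(* [sapp A [x0; ...; xn]] is A(x0, ..., xn). *)
Definition sapp (A : sform) (xs : list nat) : sform := sren (fun n => nth n xs 0) A.

Section Translation.
Variable I : interpretation.
Local Open Scope set_form_scope.

Definition SAllNum (A : sform) : sform := SAll (sapp (i_num I) [0] → A).
Definition SExNum (A : sform) : sform := SEx (sapp (i_num I) [0] ∧ A).
Definition SAllSet (A : sform) : sform := SAll (sapp (i_set I) [0] → A).
Definition SExSet (A : sform) : sform := SEx (sapp (i_set I) [0] ∧ A).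

(* [tr_term r t y] says that [y] is the value of [t], where the number variable
   [n] is represented by the set variable [r n]. *)
Fixpoint tr_term (r : nat -> nat) (t : term) (y : nat) : sform :=
  match t with
  | tvar n => r n ≡ y
  | tzero => sapp (i_zero I) [y]
  | tsucc t =>
      SExNum (tr_term (fun n => S (r n)) t 0 ∧ sapp (i_succ I) [0; S y])
  | tadd t u =>
      SExNum (SExNum (tr_term (fun n => 2 + r n) t 1
                      ∧ tr_term (fun n => 2 + r n) u 0
                      ∧ sapp (i_add I) [1; 0; 2 + y]))
  | tmul t u =>
      SExNum (SExNum (tr_term (fun n => 2 + r n) t 1
                      ∧ tr_term (fun n => 2 + r n) u 0
                      ∧ sapp (i_mul I) [1; 0; 2 + y]))
  end.

(* The number variable [n] becomes [r n] and the set variable [X] becomes [q X]. *)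
Fixpoint tr_form (r q : nat -> nat) (A : aform) : sform :=
  match A with
  | ABot => ⊥
  | AEq t u =>
      SExNum (tr_term (fun n => S (r n)) t 0 ∧ tr_term (fun n => S (r n)) u 0)
  | AMem t X =>
      SExNum (tr_term (fun n => S (r n)) t 0 ∧ sapp (i_mem I) [0; S (q X)])
  | AAnd A B => tr_form r q A ∧ tr_form r q B
  | AOr A B => tr_form r q A ∨ tr_form r q B
  | AImp A B => tr_form r q A → tr_form r q B
  | AAll1 A => SAllNum (tr_form (0 .: fun n => S (r n)) (fun X => S (q X)) A)
  | AEx1 A => SExNum (tr_form (0 .: fun n => S (r n)) (fun X => S (q X)) A)
  | AAll2 A => SAllSet (tr_form (fun n => S (r n)) (0 .: fun X => S (q X)) A)
  | AEx2 A => SExSet (tr_form (fun n => S (r n)) (0 .: fun X => S (q X)) A)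
  end.

(* For sentences the initial assignment of variables is irrelevant. *)
Definition translate (A : aform) : sform := tr_form (fun n => n) (fun X => X) A.

(* There is exactly one number satisfying [A], where index 0 is bound. *)
Definition SExUniqueNum (A : sform) : sform :=
  SExNum (A ∧ SAllNum (sren (0 .: fun n => 2 + n) A → 0 ≡ 1)).

Record is_interpretation (T : aform -> Prop) (U : sform -> Prop) : Prop := {
  num_inhabited : sprv U [] (SEx (i_num I));
  set_inhabited : sprv U [] (SEx (i_set I));
  zero_function : sprv U [] (SExUniqueNum (sapp (i_zero I) [0]));
  succ_function : sprv U [] (SAllNum (SExUniqueNum (sapp (i_succ I) [1; 0])));
  add_function :
    sprv U [] (SAllNum (SAllNum (SExUniqueNum (sapp (i_add I) [2; 1; 0]))));
  mul_function :
    sprv U [] (SAllNum (SAllNum (SExUniqueNum (sapp (i_mul I) [2; 1; 0]))));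
  theorems_preserved :
    forall A, sentence A -> aprv T [] A -> sprv U [] (translate A)
}.

End Translation.

Definition interpretable_in (T : aform -> Prop) (U : sform -> Prop) : Prop :=
  exists I : interpretation, is_interpretation I T U.

(* Main.v *)
(* By the completeness theorem for classical first-order logic, applied to
   CZF_LEM (which proves every instance of excluded middle), it suffices to verify
   the interpretation in each model of CZF_LEM. There excluded middle upgrades
   strong collection to full separation, so that, with the numbers interpreted as
   the elements of the least inductive class and the second sort as all sets,
   every second-order formula defines a set of numbers. Addition and multiplication
   are defined by iteration, and their recursion equations hold because the members
   of a set of pairs witnessing a value can be traced back to the initial value. *)
From Stdlib Require Import List Lia Arith Cantor.
From Stdlib Require Import Classical ClassicalEpsilon.
From Stdlib Require Import FunctionalExtensionality PropExtensionality.
Require Import Defs.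
Import ListNotations.

Fixpoint sat {D : Type} (E : D -> D -> Prop) (rho : nat -> D) (A : sform) : Prop :=
  match A with
  | SBot => False
  | SEq x y => rho x = rho y
  | SMem x y => E (rho x) (rho y)
  | SAnd A B => sat E rho A /\ sat E rho B
  | SOr A B => sat E rho A \/ sat E rho B
  | SImp A B => sat E rho A -> sat E rho B
  | SAll A => forall d, sat E (d .: rho) A
  | SEx A => exists d, sat E (d .: rho) A
  end.

Lemma sat_sren {D : Type} (E : D -> D -> Prop) A : forall r rho rho',
  (forall n, rho' n = rho (r n)) -> sat E rho (sren r A) <-> sat E rho' A.
Proof.
  assert (Hup : forall r (rho rho' : nat -> D) d,
             (forall n, rho' n = rho (r n)) ->
             forall n, (d .: rho') n = (d .: rho) ((0 .: fun n => S (r n)) n)).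
  { intros r rho rho' d H [|n]; simpl; auto. }
  induction A; simpl; intros r rho rho' H.
  1: tauto.
  1, 2: rewrite !H; tauto.
  1, 2, 3: rewrite (IHA1 r rho rho' H), (IHA2 r rho rho' H); tauto.
  1: split; intros HA d; apply (IHA _ (d .: rho) (d .: rho') (Hup r rho rho' d H)), HA.
  split; intros [d Hd]; exists d;
    apply (IHA _ (d .: rho) (d .: rho') (Hup r rho rho' d H)), Hd.
Qed.

Lemma sat_sapp {D : Type} (E : D -> D -> Prop) rho A xs :
  sat E rho (sapp A xs) <-> sat E (fun n => rho (nth n xs 0)) A.
Proof. apply sat_sren; reflexivity. Qed.

Lemma sren_comp A : forall r1 r2 r3,
  (forall n, r3 n = r2 (r1 n)) -> sren r2 (sren r1 A) = sren r3 A.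
Proof.
  induction A; simpl; intros r1 r2 r3 H; rewrite <- ?H;
    f_equal; auto; apply IHA; intros [|n]; simpl; auto.
Qed.

Lemma sren_id A : forall r, (forall n, r n = n) -> sren r A = A.
Proof.
  induction A; simpl; intros r H; rewrite ?H; f_equal; auto;
    apply IHA; intros [|n]; simpl; auto.
Qed.

Lemma sat_ext {D : Type} (E : D -> D -> Prop) A rho rho' :
  (forall n, rho' n = rho n) -> sat E rho A <-> sat E rho' A.
Proof. rewrite <- (sren_id A (fun n => n)) at 1; [apply sat_sren | trivial]. Qed.

Lemma sclosed_mono A : forall k l, k <= l -> sclosed k A -> sclosed l A.
Proof.
  induction A; simpl; intros k l Hkl H; try (destruct H; split); eauto; try lia.
  all: apply (IHA (S k)); [lia | assumption].
Qed.

Lemma sclosed_ex A : exists k, sclosed k A.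
Proof.
  induction A; simpl.
  1: exists 0; trivial.
  1, 2: exists (S (n + n0)); lia.
  1, 2, 3: destruct IHA1 as [k Hk], IHA2 as [l Hl]; exists (k + l); split;
    [apply (sclosed_mono _ k) | apply (sclosed_mono _ l)]; trivial; lia.
  all: destruct IHA as [k Hk]; exists k; apply (sclosed_mono _ k); trivial; lia.
Qed.

Lemma sclosed_ex_list G : exists k, forall A, In A G -> sclosed k A.
Proof.
  induction G as [|A G [k Hk]].
  - exists 0; intros A [].
  - destruct (sclosed_ex A) as [l Hl]; exists (k + l).
    intros B [<-|HB]; [apply (sclosed_mono _ l) | apply (sclosed_mono _ k)]; auto; lia.
Qed.

Lemma sren_ext A : forall k r r',
  sclosed k A -> (forall n, n < k -> r n = r' n) -> sren r A = sren r' A.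
Proof.
  induction A; simpl; intros k r r' HA H; f_equal; try (apply H; lia);
    try (destruct HA; eauto; fail);
    apply (IHA (S k)); trivial; intros [|n] Hn; simpl; trivial; f_equal; apply H; lia.
Qed.

Lemma sclosed_sren A : forall k j r,
  sclosed k A -> (forall n, n < k -> r n < j) -> sclosed j (sren r A).
Proof.
  induction A; simpl; intros k j r HA Hr; trivial; try (destruct HA; split; eauto; fail);
    (apply (IHA (S k)); trivial; intros [|n] Hn; simpl; [lia|]; specialize (Hr n); lia).
Qed.

Lemma sat_closed {D : Type} (E : D -> D -> Prop) rho rho' A :
  sclosed 0 A -> sat E rho' A -> sat E rho A.
Proof.
  intros HA H.
  set (tau := fun n => if Nat.even n then rho (Nat.div2 n) else rho' (Nat.div2 n)).
  apply (sat_sren E A (fun n => 2 * n) tau); unfold tau.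
  { intros n; now rewrite Nat.even_even, Nat.div2_double. }
  rewrite (sren_ext A 0 _ (fun n => S (2 * n)) HA) by lia.
  apply (sat_sren E A _ _ rho'); trivial.
  intros n; now rewrite Nat.even_succ, Nat.odd_even, Nat.div2_succ_double.
Qed.

(** * Completeness *)

Section Deduction.
Variable T : sform -> Prop.

Lemma sprv_weak G A : sprv T G A -> forall G', incl G G' -> sprv T G' A.
Proof.
  assert (Hcons : forall (B : sform) G G', incl G G' -> incl (B :: G) (B :: G')).
  { intros B G0 G0' H; apply incl_cons; [now left | now apply incl_tl]. }
  induction 1; intros G' HG.
  - apply s_hyp; auto.
  - now apply s_ax.
  - apply s_botE; auto.
  - apply s_andI; auto.
  - eapply s_andE1; auto.
  - eapply s_andE2; auto.
  - apply s_orI1; auto.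
  - apply s_orI2; auto.
  - eapply s_orE; auto.
  - apply s_impI; auto.
  - eapply s_impE; auto.
  - apply s_allI, IHsprv, incl_map, HG.
  - apply s_allE; auto.
  - eapply s_exI; auto.
  - eapply s_exE; [auto | apply IHsprv2, Hcons, incl_map, HG].
  - apply s_refl.
  - eapply s_leibniz; auto.
Qed.

Definition impl_list (G : list sform) (A : sform) : sform := fold_left (fun B C => SImp C B) G A.

Lemma sprv_discharge G : forall A, sprv T G A -> sprv T [] (impl_list G A).
Proof. induction G as [|B G IH]; simpl; intros A H; [exact H | apply IH, s_impI, H]. Qed.

Lemma sprv_undischarge G' G : forall A,
  sprv T G' (impl_list G A) -> (forall B, In B G -> sprv T G' B) -> sprv T G' A.
Proof.
  induction G as [|B G IH]; simpl; intros A H HG; [exact H|].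
  apply s_impE with B; auto.
Qed.

Lemma sprv_cut G' G A : (forall B, In B G -> sprv T G' B) -> sprv T G A -> sprv T G' A.
Proof.
  intros HG H; apply (sprv_undischarge G' G); trivial.
  apply (sprv_weak []); [now apply sprv_discharge | intros B []].
Qed.

Lemma sren_impl_list r G : forall A,
  sren r (impl_list G A) = impl_list (map (sren r) G) (sren r A).
Proof. induction G as [|B G IH]; simpl; intros A; [reflexivity | apply IH]. Qed.

Lemma sprv_generalize k : forall A, sprv T [] A -> sprv T [] (Nat.iter k SAll A).
Proof. induction k; simpl; intros A H; [exact H | apply s_allI; simpl; auto]. Qed.

Lemma sprv_specialize k : forall A r, (forall n, r (k + n) = n) ->
  sprv T [] (Nat.iter k SAll A) -> sprv T [] (sren r A).
Proof.
  induction k; intros A r Hr H.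
  - rewrite sren_id; auto.
  - rewrite Nat.iter_succ_r in H.
    apply IHk with (r := fun n => r (S n)) in H; [|exact Hr].
    apply s_allE with (x := r 0) in H; unfold sinst in H.
    rewrite (sren_comp _ _ _ r) in H; trivial.
    intros [|n]; reflexivity.
Qed.

Lemma sprv_sren_nil r A : sprv T [] A -> sprv T [] (sren r A).
Proof.
  intros H; destruct (sclosed_ex A) as [k Hk].
  rewrite (sren_ext A k r (fun n => if n <? k then r n else n - k) Hk).
  - apply (sprv_specialize k); [|now apply sprv_generalize].
    intros n; destruct (Nat.ltb_spec (k + n) k); lia.
  - intros n Hn; destruct (Nat.ltb_spec n k); [trivial | lia].
Qed.

Lemma sprv_sren r G A : sprv T G A -> sprv T (map (sren r) G) (sren r A).
Proof.
  intros H; apply (sprv_undischarge _ (map (sren r) G)); [|intros B; apply s_hyp].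
  rewrite <- sren_impl_list; apply (sprv_weak []); [|intros B []].
  now apply sprv_sren_nil, sprv_discharge.
Qed.

Lemma sprv_witness c G A :
  (forall B, In B (SEx A :: G) -> sclosed c B) ->
  sprv T (sinst A c :: SEx A :: G) SBot -> sprv T (SEx A :: G) SBot.
Proof.
  intros Hc H.
  apply s_exE with A; [apply s_hyp; now left|].
  set (r := fun n => if n <? c then S n else 0).
  assert (Hr : forall n, n < c -> r n = S n).
  { intros n Hn; unfold r; destruct (Nat.ltb_spec n c); lia. }
  assert (Hrc : r c = 0) by (unfold r; destruct (Nat.ltb_spec c c); lia).
  assert (HA : sren r (sinst A c) = A).
  { unfold sinst; rewrite (sren_comp A _ _ (fun n => r ((c .: fun m => m) n))) by reflexivity.
    rewrite (sren_ext A (S c) _ (fun n => n)), sren_id; trivial.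
    - apply (Hc (SEx A)); now left.
    - intros [|n] Hn; cbn [scons]; [exact Hrc | apply Hr; lia]. }
  apply (sprv_sren r) in H; rewrite map_cons, HA, (map_ext_in _ (sren S)) in H; [exact H|].
  intros B HB; apply (sren_ext B c); auto.
Qed.

End Deduction.

Fixpoint code (A : sform) : nat :=
  match A with
  | SBot => to_nat (0, 0)
  | SEq x y => to_nat (1, to_nat (x, y))
  | SMem x y => to_nat (2, to_nat (x, y))
  | SAnd A B => to_nat (3, to_nat (code A, code B))
  | SOr A B => to_nat (4, to_nat (code A, code B))
  | SImp A B => to_nat (5, to_nat (code A, code B))
  | SAll A => to_nat (6, code A)
  | SEx A => to_nat (7, code A)
  end.

Lemma to_nat_pair_inj a b c d : to_nat (a, b) = to_nat (c, d) -> a = c /\ b = d.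
Proof. intros H; apply to_nat_inj in H; now injection H. Qed.

Lemma code_inj A : forall B, code A = code B -> A = B.
Proof.
  induction A; intros []; cbn [code]; intros H;
    apply to_nat_pair_inj in H; destruct H as [Htag H]; try discriminate Htag;
    try (apply to_nat_pair_inj in H; destruct H); subst; f_equal; auto.
Qed.

Definition decode (n : nat) : sform := epsilon (inhabits SBot) (fun A => code A = n).

Lemma decode_code A : decode (code A) = A.
Proof. apply code_inj, (epsilon_spec (inhabits SBot) (fun B => code B = code A)); eauto. Qed.

Definition fresh (G : list sform) : nat :=
  epsilon (inhabits 0) (fun k => forall A, In A G -> sclosed k A).

Lemma fresh_spec G A : In A G -> sclosed (fresh G) A.
Proof.
  revert A; apply (epsilon_spec (inhabits 0) (fun k => forall A, In A G -> sclosed k A)).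
  apply sclosed_ex_list.
Qed.

Section Henkin.
Variable T : sform -> Prop.
Hypothesis T_lem : forall A, T (SOr A (SImp A SBot)).

(* Each stage is a finite list of formulas, so that an unused variable can serve
   as the witness and no new constants are needed. *)
Definition henkin_step (A : sform) (G : list sform) : list sform :=
  if excluded_middle_informative (sprv T (A :: G) SBot) then G
  else match A with
       | SEx B => sinst B (fresh (A :: G)) :: A :: G
       | _ => A :: G
       end.

Fixpoint henkin (G : list sform) (n : nat) : list sform :=
  match n with
  | 0 => G
  | S n => henkin_step (decode n) (henkin G n)
  end.

Lemma henkin_step_incl A G : incl G (henkin_step A G).
Proof.
  unfold henkin_step; destruct excluded_middle_informative; [apply incl_refl|].
  destruct A; intros B HB; simpl; auto.
Qed.

Lemma henkin_step_con A G : ~ sprv T G SBot -> ~ sprv T (henkin_step A G) SBot.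
Proof.
  unfold henkin_step; destruct excluded_middle_informative as [|H]; trivial.
  intros _; destruct A; trivial.
  intros HB; apply H; eapply sprv_witness; [|exact HB].
  apply fresh_spec.
Qed.

Variable G0 : list sform.
Hypothesis G0_con : ~ sprv T G0 SBot.

Lemma henkin_con n : ~ sprv T (henkin G0 n) SBot.
Proof. induction n; simpl; [exact G0_con | now apply henkin_step_con]. Qed.

Lemma henkin_mono n m : n <= m -> incl (henkin G0 n) (henkin G0 m).
Proof.
  induction 1; [apply incl_refl|].
  eapply incl_tran; [eassumption | apply henkin_step_incl].
Qed.

Definition thy (A : sform) : Prop := exists n, sprv T (henkin G0 n) A.

Lemma thy_ded L A : (forall B, In B L -> thy B) -> sprv T L A -> thy A.
Proof.
  intros HL HA.
  assert (H : exists n, forall B, In B L -> sprv T (henkin G0 n) B).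
  { clear HA; induction L as [|B L IH].
    - exists 0; intros B [].
    - destruct IH as [n Hn]; [intros C HC; apply HL; now right|].
      destruct (HL B (or_introl eq_refl)) as [m Hm].
      exists (n + m); intros C [<-|HC].
      + apply (sprv_weak _ _ _ Hm), henkin_mono; lia.
      + apply (sprv_weak _ _ _ (Hn C HC)), henkin_mono; lia. }
  destruct H as [n Hn]; exists n; now apply sprv_cut with L.
Qed.

Lemma thy_bot : ~ thy SBot.
Proof. intros [n Hn]; exact (henkin_con n Hn). Qed.

Lemma thy_step A : thy (SImp A SBot) \/
  incl (henkin_step A (henkin G0 (code A))) (henkin G0 (S (code A))) /\
  ~ sprv T (A :: henkin G0 (code A)) SBot.
Proof.
  destruct (classic (sprv T (A :: henkin G0 (code A)) SBot)) as [H|H].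
  - left; exists (code A); now apply s_impI.
  - right; split; trivial; simpl; rewrite decode_code; apply incl_refl.
Qed.

Lemma thy_neg A : thy (SImp A SBot) <-> ~ thy A.
Proof.
  split.
  - intros H HA; apply thy_bot, (thy_ded [SImp A SBot; A]).
    + intros B [<-|[<-|[]]]; trivial.
    + apply s_impE with A; apply s_hyp; simpl; auto.
  - intros H; destruct (thy_step A) as [|[Hs Hc]]; trivial.
    contradict H; exists (S (code A)); apply s_hyp, Hs.
    unfold henkin_step; destruct excluded_middle_informative; [contradiction|].
    destruct A; simpl; auto.
Qed.

Lemma thy_ded1 A B : sprv T [A] B -> thy A -> thy B.
Proof. intros H HA; apply (thy_ded [A]); trivial; intros C [<-|[]]; trivial. Qed.

Lemma thy_ded2 A B C : sprv T [A; B] C -> thy A -> thy B -> thy C.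
Proof. intros H HA HB; apply (thy_ded [A; B]); trivial; intros D [<-|[<-|[]]]; trivial. Qed.

Lemma thy_and A B : thy (SAnd A B) <-> thy A /\ thy B.
Proof.
  split.
  - intros H; split; revert H; apply thy_ded1;
      [apply s_andE1 with B | apply s_andE2 with A]; apply s_hyp; simpl; auto.
  - intros [HA HB]; revert HA HB; apply thy_ded2, s_andI; apply s_hyp; simpl; auto.
Qed.

Lemma thy_imp A B : thy (SImp A B) <-> (thy A -> thy B).
Proof.
  split.
  - apply thy_ded2, s_impE with A; apply s_hyp; simpl; auto.
  - intros H; destruct (classic (thy A)) as [HA|HA].
    + apply (thy_ded1 B); [apply s_impI, s_hyp; simpl; auto | auto].
    + apply thy_neg in HA; revert HA; apply thy_ded1, s_impI, s_botE.
      apply s_impE with A; apply s_hyp; simpl; auto.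
Qed.

Lemma thy_or A B : thy (SOr A B) <-> thy A \/ thy B.
Proof.
  split.
  - intros H; apply NNPP; intros Hn; apply not_or_and in Hn as [HA HB].
    apply thy_neg in HA; apply thy_neg in HB.
    apply thy_bot, (thy_ded [SOr A B; SImp A SBot; SImp B SBot]).
    + intros C [<-|[<-|[<-|[]]]]; trivial.
    + apply s_orE with A B; [apply s_hyp; simpl; auto| |].
      * apply s_impE with A; apply s_hyp; simpl; auto.
      * apply s_impE with B; apply s_hyp; simpl; auto.
  - intros [H|H]; revert H; apply thy_ded1; [apply s_orI1 | apply s_orI2]; apply s_hyp; simpl; auto.
Qed.

Lemma thy_ex A : thy (SEx A) <-> exists c, thy (sinst A c).
Proof.
  split.
  - intros H; destruct (thy_step (SEx A)) as [Hn|[Hs Hc]].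
    + now apply thy_neg in Hn.
    + unfold henkin_step in Hs; destruct excluded_middle_informative; [contradiction|].
      eexists; exists (S (code (SEx A))); apply s_hyp, Hs; simpl; auto.
  - intros [c Hc]; revert Hc; apply thy_ded1, s_exI with c, s_hyp; simpl; auto.
Qed.

Lemma sprv_not_ex_not A : sprv T [SImp (SEx (SImp A SBot)) SBot] (SAll A).
Proof.
  apply s_allI; simpl.
  apply s_orE with A (SImp A SBot); [apply s_ax, T_lem | apply s_hyp; simpl; auto |].
  apply s_botE, s_impE with (SEx (SImp (sren (0 .: fun n => S (S n)) A) SBot));
    [apply s_hyp; simpl; auto|].
  apply s_exI with 0; unfold sinst; simpl.
  rewrite (sren_comp A _ _ (fun n => n)), (sren_id A (fun n => n));
    [apply s_hyp; simpl; auto | reflexivity |].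
  intros [|n]; reflexivity.
Qed.

Lemma thy_all A : thy (SAll A) <-> forall c, thy (sinst A c).
Proof.
  split.
  - intros H c; revert H; apply thy_ded1, s_allE, s_hyp; simpl; auto.
  - intros H; apply (thy_ded1 _ _ (sprv_not_ex_not A)), thy_neg.
    intros Hex; apply thy_ex in Hex as [c Hc].
    apply (proj1 (thy_neg (sinst A c))) in Hc; auto.
Qed.

Lemma thy_leibniz A x y : thy (SEq x y) -> thy (sinst A x) -> thy (sinst A y).
Proof. apply thy_ded2, s_leibniz with x; apply s_hyp; simpl; auto. Qed.

Lemma thy_refl x : thy (SEq x x).
Proof. exists 0; apply s_refl. Qed.

Lemma thy_sym x y : thy (SEq x y) -> thy (SEq y x).
Proof. intros H; apply (thy_leibniz (SEq 0 (S x)) x y H), thy_refl. Qed.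

Lemma thy_trans x y z : thy (SEq x y) -> thy (SEq y z) -> thy (SEq x z).
Proof. intros Hx Hy; exact (thy_leibniz (SEq (S x) 0) y z Hy Hx). Qed.

Definition henkin_model : Type := {P : nat -> Prop | exists x, P = fun y => thy (SEq x y)}.

Definition cls (x : nat) : henkin_model :=
  exist _ (fun y => thy (SEq x y)) (ex_intro _ x eq_refl).

Lemma cls_surj d : exists x, d = cls x.
Proof. destruct d as [P [x ->]]; exists x; reflexivity. Qed.

Lemma cls_eq x y : cls x = cls y <-> thy (SEq x y).
Proof.
  split.
  - intros H; apply (f_equal (@proj1_sig _ _)) in H; simpl in H.
    change ((fun z => thy (SEq x z)) y); rewrite H; apply thy_refl.
  - intros H; apply eq_sig_hprop; simpl; [intros; apply proof_irrelevance|].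
    apply functional_extensionality; intros z; apply propositional_extensionality.
    split; intros Hz; [apply thy_trans with x | apply thy_trans with y]; trivial.
    now apply thy_sym.
Qed.

Definition henkin_mem (d e : henkin_model) : Prop :=
  exists x y, d = cls x /\ e = cls y /\ thy (SMem x y).

Lemma henkin_mem_cls x y : henkin_mem (cls x) (cls y) <-> thy (SMem x y).
Proof.
  split; [|firstorder].
  intros [x' [y' [Hx [Hy H]]]]; apply cls_eq, thy_sym in Hx; apply cls_eq, thy_sym in Hy.
  apply (thy_leibniz (SMem (S x) 0) y' y Hy), (thy_leibniz (SMem 0 (S y')) x' x Hx), H.
Qed.

Lemma henkin_truth A : forall r, sat henkin_mem (fun n => cls (r n)) A <-> thy (sren r A).
Proof.
  assert (Hup : forall B r d, (forall r, sat henkin_mem (fun n => cls (r n)) B <-> thy (sren r B)) ->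
     sat henkin_mem (cls d .: fun n => cls (r n)) B <-> thy (sinst (sren (0 .: fun n => S (r n)) B) d)).
  { clear A; intros A r d IH.
    rewrite <- (sat_ext _ A (fun n => cls ((d .: r) n))) by (intros [|n]; reflexivity).
    rewrite IH; unfold sinst; rewrite (sren_comp A _ _ (d .: r)); [tauto|].
    intros [|n]; reflexivity. }
  induction A; simpl; intros r.
  - split; [tauto | apply thy_bot].
  - apply cls_eq.
  - apply henkin_mem_cls.
  - rewrite thy_and, IHA1, IHA2; tauto.
  - rewrite thy_or, IHA1, IHA2; tauto.
  - rewrite thy_imp, IHA1, IHA2; tauto.
  - rewrite thy_all; split; intros H d.
    + apply (Hup A r d IHA), H.
    + destruct (cls_surj d) as [c ->]; apply (Hup A r c IHA), H.
  - rewrite thy_ex; split.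
    + intros [d H]; destruct (cls_surj d) as [c ->]; exists c; apply (Hup A r c IHA), H.
    + intros [c H]; exists (cls c); apply (Hup A r c IHA), H.
Qed.

Lemma henkin_model_sat B rho : T B -> sat henkin_mem rho B.
Proof.
  intros HB; destruct (choice (fun n x => rho n = cls x)) as [r Hr]; [intros n; apply cls_surj|].
  apply (sat_ext _ B (fun n => cls (r n)) _ Hr).
  apply henkin_truth; exists 0; apply (sprv_weak _ []); [|intros C []].
  now apply sprv_sren_nil, s_ax.
Qed.

End Henkin.

Theorem completeness (T : sform -> Prop) (A : sform) :
  (forall B, T (SOr B (SImp B SBot))) ->
  (forall (D : Type) (E : D -> D -> Prop),
     (forall B rho, T B -> sat E rho B) -> forall rho, sat E rho A) ->
  sprv T [] A.
Proof.
  intros HT HA; apply NNPP; intros HnA.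
  assert (Hcon : ~ sprv T [SImp A SBot] SBot).
  { intros H; apply HnA, s_orE with A (SImp A SBot); [apply s_ax, HT | |].
    - apply s_hyp; simpl; auto.
    - now apply s_botE. }
  specialize (HA _ _ (henkin_model_sat T HT _ Hcon) (fun n => cls T _ n)).
  apply (henkin_truth T HT _ Hcon A (fun n => n)) in HA; rewrite sren_id in HA; trivial.
  revert HA; apply thy_neg; trivial.
  exists 0; apply s_hyp; simpl; auto.
Qed.

(** * Second-order arithmetic *)

Section ArithmeticSemantics.
Variables (N V : Type) (zero : N) (sc : N -> N) (add mul : N -> N -> N) (mem : N -> V -> Prop).

Fixpoint teval (e : nat -> N) (t : term) : N :=
  match t with
  | tvar n => e n
  | tzero => zero
  | tsucc t => sc (teval e t)
  | tadd t u => add (teval e t) (teval e u)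
  | tmul t u => mul (teval e t) (teval e u)
  end.

Fixpoint asat (e : nat -> N) (v : nat -> V) (A : aform) : Prop :=
  match A with
  | ABot => False
  | AEq t u => teval e t = teval e u
  | AMem t X => mem (teval e t) (v X)
  | AAnd A B => asat e v A /\ asat e v B
  | AOr A B => asat e v A \/ asat e v B
  | AImp A B => asat e v A -> asat e v B
  | AAll1 A => forall n, asat (n .: e) v A
  | AEx1 A => exists n, asat (n .: e) v A
  | AAll2 A => forall X, asat e (X .: v) A
  | AEx2 A => exists X, asat e (X .: v) A
  end.

Lemma teval_tsub t : forall s e e',
  (forall n, e' n = teval e (s n)) -> teval e (tsub s t) = teval e' t.
Proof. induction t; simpl; intros s e e' H; rewrite ?H; f_equal; auto. Qed.

Lemma asat_asub A : forall s r e e' v v',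
  (forall n, e' n = teval e (s n)) -> (forall X, v' X = v (r X)) ->
  asat e v (asub s r A) <-> asat e' v' A.
Proof.
  assert (Hup1 : forall s (e e' : nat -> N) n, (forall n, e' n = teval e (s n)) ->
    forall k, (n .: e') k = teval (n .: e) ((tvar 0 .: fun n => tshift (s n)) k)).
  { intros s e e' n H [|k]; simpl; trivial.
    unfold tshift; rewrite (teval_tsub _ _ _ e); auto. }
  assert (Hup2 : forall r (v v' : nat -> V) X, (forall X, v' X = v (r X)) ->
    forall k, (X .: v') k = (X .: v) ((0 .: fun n => S (r n)) k)).
  { intros r v v' X H [|k]; simpl; auto. }
  induction A; simpl; intros s r e e' v v' He Hv.
  - tauto.
  - rewrite !(teval_tsub _ _ _ e'); tauto.
  - rewrite (teval_tsub _ _ _ e'), Hv; tauto.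
  - rewrite (IHA1 s r e e' v v'), (IHA2 s r e e' v v'); tauto.
  - rewrite (IHA1 s r e e' v v'), (IHA2 s r e e' v v'); tauto.
  - rewrite (IHA1 s r e e' v v'), (IHA2 s r e e' v v'); tauto.
  - split; intros H n; apply (IHA _ _ _ _ _ _ (Hup1 s e e' n He) Hv), H.
  - split; intros [n H]; exists n; apply (IHA _ _ _ _ _ _ (Hup1 s e e' n He) Hv), H.
  - split; intros H X; apply (IHA _ _ _ _ _ _ He (Hup2 r v v' X Hv)), H.
  - split; intros [X H]; exists X; apply (IHA _ _ _ _ _ _ He (Hup2 r v v' X Hv)), H.
Qed.

Lemma asat_ashift1 A e v n : asat (n .: e) v (ashift1 A) <-> asat e v A.
Proof. now apply asat_asub. Qed.

Lemma asat_ashift2 A e v X : asat e (X .: v) (ashift2 A) <-> asat e v A.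
Proof. now apply asat_asub. Qed.

Lemma asat_ainst1 A e v t : asat e v (ainst1 A t) <-> asat (teval e t .: e) v A.
Proof. apply asat_asub; now intros [|n]. Qed.

Lemma asat_ainst2 A e v X : asat e v (ainst2 A X) <-> asat e (v X .: v) A.
Proof. apply asat_asub; now intros [|n]. Qed.

Lemma aprv_sound T G A : (forall B e v, T B -> asat e v B) -> aprv T G A ->
  forall e v, (forall B, In B G -> asat e v B) -> asat e v A.
Proof.
  intros HT.
  assert (Hcons : forall A G e v, asat e v A -> (forall B, In B G -> asat e v B) ->
            forall B, In B (A :: G) -> asat e v B).
  { intros A0 G0 e v HA HG B [<-|HB]; auto. }
  assert (Hsh1 : forall G e v n, (forall B, In B G -> asat e v B) ->
            forall B, In B (map ashift1 G) -> asat (n .: e) v B).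
  { intros G0 e v n HG B HB; apply in_map_iff in HB as [C [<- HC]].
    now apply asat_ashift1, HG. }
  assert (Hsh2 : forall G e v X, (forall B, In B G -> asat e v B) ->
            forall B, In B (map ashift2 G) -> asat e (X .: v) B).
  { intros G0 e v X HG B HB; apply in_map_iff in HB as [C [<- HC]].
    now apply asat_ashift2, HG. }
  induction 1; intros e v HG; simpl in *.
  - auto.
  - auto.
  - apply NNPP; intros Hn; exact (IHaprv e v HG Hn).
  - destruct (IHaprv e v HG).
  - auto.
  - apply (IHaprv e v HG).
  - apply (IHaprv e v HG).
  - left; auto.
  - right; auto.
  - destruct (IHaprv1 e v HG); [apply IHaprv2 | apply IHaprv3]; apply Hcons; auto.
  - intros HA; apply IHaprv, Hcons; auto.
  - apply (IHaprv1 e v HG), IHaprv2, HG.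
  - intros n; apply IHaprv, Hsh1, HG.
  - apply asat_ainst1, IHaprv, HG.
  - exists (teval e t); apply asat_ainst1, IHaprv, HG.
  - destruct (IHaprv1 e v HG) as [n Hn]; apply (asat_ashift1 C e v n), IHaprv2.
    apply Hcons; [exact Hn | now apply Hsh1].
  - intros X; apply IHaprv, Hsh2, HG.
  - apply asat_ainst2, IHaprv, HG.
  - exists (v X); apply asat_ainst2, IHaprv, HG.
  - destruct (IHaprv1 e v HG) as [X HX]; apply (asat_ashift2 C e v X), IHaprv2.
    apply Hcons; [exact HX | now apply Hsh2].
  - reflexivity.
  - apply asat_ainst1; rewrite <- (IHaprv1 e v HG); apply asat_ainst1, IHaprv2, HG.
Qed.

End ArithmeticSemantics.

(** * Sets and natural numbers in a model *)

Definition fEmpty (x : nat) : sform := (SAll (¬ 0 ∈ S x))%sf.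
Definition fSucc (x y : nat) : sform := (SAll (0 ∈ S y ↔ 0 ∈ S x ∨ 0 ≡ S x))%sf.
Definition fUpair (x y z : nat) : sform := (SAll (0 ∈ S z ↔ 0 ≡ S x ∨ 0 ≡ S y))%sf.
Definition fPair (x y z : nat) : sform :=
  (SEx (SEx (fUpair (2 + x) (2 + x) 1 ∧ fUpair (2 + x) (2 + y) 0 ∧ fUpair 1 0 (2 + z))))%sf.
Definition fPairIn (x y f : nat) : sform := (SEx (0 ∈ S f ∧ fPair (S x) (S y) 0))%sf.
Definition fNum (x : nat) : sform :=
  (SAll (SEx (fEmpty 0 ∧ 0 ∈ 1) ∧ SAllIn 0 (SEx (fSucc 1 0 ∧ 0 ∈ 2)) → S x ∈ 0))%sf.

(* The value at [n] of the function iterating the relation H(p, -, -) from [a]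
   is [y]: some set of pairs contains (n, y) and traces each of its members back
   to (0, a). *)
Definition fIter (H : sform) (p a n y : nat) : sform :=
  (SEx (fPairIn (S n) (S y) 0 ∧
        SAll (SAll (fPairIn 1 0 2 →
          (fEmpty 1 ∧ 0 ≡ 3 + a) ∨
          SEx (SEx (fSucc 1 3 ∧ sapp H [5 + p; 0; 2] ∧ fPairIn 1 0 4))))))%sf.

Definition fAdd : sform := fIter (fSucc 1 2) 0 0 1 2.
Definition fMul : sform := (SEx (fEmpty 0 ∧ fIter (sapp fAdd [1; 0; 2]) 1 0 2 3))%sf.

(* Every set may serve as a set of numbers: only its numerical members matter. *)
Definition PA2_in_sets : interpretation.
Proof.
  refine {| i_num := fNum 0; i_set := SEq 0 0; i_zero := fEmpty 0; i_succ := fSucc 0 1;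
            i_add := fAdd; i_mul := fMul; i_mem := SMem 0 1 |};
    cbn; repeat split; lia.
Defined.

Section Closedness.
Variable I : interpretation.

Lemma sclosed_sapp k A xs j : sclosed k A -> length xs = k ->
  (forall x, In x xs -> x < j) -> sclosed j (sapp A xs).
Proof.
  intros HA Hk Hxs; apply (sclosed_sren _ k); trivial.
  intros n Hn; apply Hxs, nth_In; lia.
Qed.

Lemma sclosed_i_num j : sclosed (S j) (sapp (i_num I) [0]).
Proof. apply (sclosed_sapp 1); [apply i_num_closed | reflexivity | simpl; intros x [<-|[]]; lia]. Qed.

Lemma tr_term_closed t : forall k j r y, tclosed k t -> (forall n, n < k -> r n < j) -> y < j ->
  sclosed j (tr_term I r t y).
Proof.
  induction t; simpl; intros k j r y Ht Hr Hy.
  - auto.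
  - apply (sclosed_sapp 1); [apply i_zero_closed | reflexivity | simpl; intros x [<-|[]]; lia].
  - repeat split; [apply sclosed_i_num | eapply IHt; eauto; [|lia] |].
    + intros n Hn; apply Hr in Hn; lia.
    + apply (sclosed_sapp 2); [apply i_succ_closed | reflexivity | simpl; intros x [<-|[<-|[]]]; lia].
  - destruct Ht as [Ht1 Ht2].
    assert (Hr' : forall n, n < k -> S (S (r n)) < S (S j)) by (intros n Hn; apply Hr in Hn; lia).
    repeat split; try apply sclosed_i_num.
    + eapply IHt1; eauto; lia.
    + eapply IHt2; eauto; lia.
    + apply (sclosed_sapp 3); [apply i_add_closed | reflexivity | simpl; intros x [<-|[<-|[<-|[]]]]; lia].
  - destruct Ht as [Ht1 Ht2].
    assert (Hr' : forall n, n < k -> S (S (r n)) < S (S j)) by (intros n Hn; apply Hr in Hn; lia).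
    repeat split; try apply sclosed_i_num.
    + eapply IHt1; eauto; lia.
    + eapply IHt2; eauto; lia.
    + apply (sclosed_sapp 3); [apply i_mul_closed | reflexivity | simpl; intros x [<-|[<-|[<-|[]]]]; lia].
Qed.

Lemma tr_form_closed A : forall k l j r q, aclosed k l A ->
  (forall n, n < k -> r n < j) -> (forall X, X < l -> q X < j) -> sclosed j (tr_form I r q A).
Proof.
  assert (Hup : forall k j r, (forall n, n < k -> r n < j) ->
    forall n, n < S k -> (0 .: fun n => S (r n)) n < S j).
  { intros k j r Hr [|n] Hn; simpl; [lia|]; specialize (Hr n); lia. }
  assert (Hsh : forall k j r, (forall n, n < k -> r n < j) -> forall n, n < k -> S (r n) < S j).
  { intros k j r Hr n Hn; specialize (Hr n); lia. }
  assert (Hset : forall j, sclosed (S j) (sapp (i_set I) [0])).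
  { intros j; apply (sclosed_sapp 1); [apply i_set_closed | reflexivity | simpl; intros x [<-|[]]; lia]. }
  induction A; simpl; intros k l j r q HA Hr Hq.
  - trivial.
  - destruct HA as [Ht Hu]; split; [apply sclosed_i_num|].
    split; [apply (tr_term_closed t k) | apply (tr_term_closed t0 k)];
      first [assumption | lia | now apply Hsh].
  - destruct HA as [Ht HX]; apply Hq in HX; split; [apply sclosed_i_num|].
    split; [apply (tr_term_closed t k); first [assumption | lia | now apply Hsh]|].
    apply (sclosed_sapp 2); [apply i_mem_closed | reflexivity | simpl; intros x [<-|[<-|[]]]; lia].
  - destruct HA; eauto.
  - destruct HA; eauto.
  - destruct HA; eauto.
  - split; [apply sclosed_i_num | eapply IHA; eauto].
  - split; [apply sclosed_i_num | eapply IHA; eauto].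
  - split; [apply Hset | eapply IHA; eauto].
  - split; [apply Hset | eapply IHA; eauto].
Qed.

Lemma translate_closed A : sentence A -> sclosed 0 (translate I A).
Proof. intros HA; apply (tr_form_closed A 0 0); trivial; lia. Qed.

End Closedness.

Section Model.
Variables (D : Type) (E : D -> D -> Prop).
Hypothesis D_model : forall B rho, CZF_LEM B -> sat E rho B.
Variable d0 : D.

Lemma D_ext a b : (forall z, E z a <-> E z b) -> a = b.
Proof.
  exact (D_model _ (fun _ => d0) (or_introl CZF_ext) a b).
Qed.

Lemma D_pair a b : exists c, forall x, E x c <-> x = a \/ x = b.
Proof. exact (D_model _ (fun _ => d0) (or_introl CZF_pair) a b). Qed.

Lemma D_union a : exists c, forall x, E x c <-> exists z, E z a /\ E x z.
Proof. exact (D_model _ (fun _ => d0) (or_introl CZF_union) a). Qed.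

Lemma D_inf : exists w, (exists u, E u w /\ forall z, ~ E z u) /\
  forall u, E u w -> exists v, E v w /\ forall z, E z v <-> E z u \/ z = u.
Proof. exact (D_model _ (fun _ => d0) (or_introl CZF_inf)). Qed.

Lemma D_ind A rho :
  (forall x, (forall y, E y x -> sat E (y .: rho) A) -> sat E (x .: rho) A) ->
  forall x, sat E (x .: rho) A.
Proof.
  intros H; apply (D_model _ rho (or_introl (CZF_set_induction A))); simpl.
  intros x Hx; apply H; intros y Hy.
  refine (proj1 (sat_sren _ A _ _ _ _) (Hx y Hy)); now intros [|n].
Qed.

Lemma D_scoll A rho a :
  (forall x, E x a -> exists y, sat E (y .: x .: a .: rho) A) ->
  exists b, (forall x, E x a -> exists y, E y b /\ sat E (y .: x .: a .: rho) A) /\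
            (forall y, E y b -> exists x, E x a /\ sat E (y .: x .: a .: rho) A).
Proof.
  intros H.
  destruct (D_model _ rho (or_introl (CZF_scoll A)) a H) as [b [H1 H2]]; exists b; simpl in H1, H2.
  split.
  - intros x Hx; destruct (H1 x Hx) as [y [Hy Hxy]]; exists y; split; trivial.
    refine (proj1 (sat_sren _ A _ _ _ _) Hxy); now intros [|[|[|n]]].
  - intros y Hy; destruct (H2 y Hy) as [x [Hx Hxy]]; exists x; split; trivial.
    refine (proj1 (sat_sren _ A _ _ _ _) Hxy); now intros [|[|[|n]]].
Qed.

Lemma D_emp_ex : exists e, forall z, ~ E z e.
Proof. destruct D_inf as [w [[u [_ Hu]] _]]; now exists u. Qed.

Lemma D_sep A rho a : exists b, forall x, E x b <-> E x a /\ sat E (x .: rho) A.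
Proof.
  destruct (classic (exists e, E e a /\ sat E (e .: rho) A)) as [[e [He HeA]]|Hn].
  (* Collect on [a] the function that is the identity where [A] holds and
     constantly [e] elsewhere: its range is the required set. *)
  - set (A' := sren (1 .: fun n => 4 + n) A).
    assert (HA' : forall y x, sat E (y .: x .: a .: e .: rho) A' <-> sat E (x .: rho) A).
    { intros y x; apply sat_sren; now intros [|n]. }
    destruct (D_scoll (A' ∧ 0 ≡ 1 ∨ (¬ A') ∧ 0 ≡ 3)%sf (e .: rho) a) as [b [H1 H2]].
    + intros x _; destruct (classic (sat E (x .: rho) A)).
      * exists x; left; split; [now apply HA' | reflexivity].
      * exists e; right; split; [intros HA; now apply HA' in HA | reflexivity].
    + exists b; intros x; split.
      * intros Hx; destruct (H2 x Hx) as [x' [Hx' [[HA Heq]|[_ Heq]]]]; cbn in Heq; subst.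
        -- split; trivial; now apply HA' in HA.
        -- now split.
      * intros [Hx HA]; destruct (H1 x Hx) as [y [Hy [[_ Heq]|[HnA _]]]].
        -- cbn in Heq; now subst.
        -- exfalso; apply HnA, HA', HA.
  - destruct D_emp_ex as [z Hz]; exists z; intros x; split; [intros Hx; now apply Hz in Hx|].
    intros Hx; contradict Hn; eauto.
Qed.

Lemma D_no_cycle x y : E x y -> ~ E y x.
Proof.
  intros Hxy Hyx; revert y Hxy Hyx.
  apply (D_ind (SAll (1 ∈ 0 → 0 ∈ 1 → ⊥))%sf (fun _ => d0)); simpl.
  intros z IH y Hzy Hyz; exact (IH y Hyz z Hyz Hzy).
Qed.

Definition emp : D := epsilon (inhabits d0) (fun e => forall z, ~ E z e).

Lemma in_emp z : ~ E z emp.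
Proof.
  exact (epsilon_spec (inhabits d0) (fun e => forall z, ~ E z e) D_emp_ex z).
Qed.

Lemma adj_ex x y : exists c, forall z, E z c <-> E z x \/ z = y.
Proof.
  destruct (D_pair y y) as [s Hs], (D_pair x s) as [p Hp], (D_union p) as [c Hc].
  exists c; intros z; rewrite Hc; split.
  - intros [w [Hw Hz]]; apply Hp in Hw as [->| ->]; [now left | right; apply Hs in Hz; tauto].
  - intros [Hz| ->]; [exists x | exists s]; rewrite Hp; split; auto.
    apply Hs; now left.
Qed.

Definition adj (x y : D) : D :=
  epsilon (inhabits d0) (fun c => forall z, E z c <-> E z x \/ z = y).

Lemma in_adj x y z : E z (adj x y) <-> E z x \/ z = y.
Proof.
  exact (epsilon_spec (inhabits d0) (fun c => forall z, E z c <-> E z x \/ z = y) (adj_ex x y) z).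
Qed.

Definition succ (x : D) : D := adj x x.
Definition upair (x y : D) : D := adj (adj emp x) y.
Definition opair (x y : D) : D := upair (upair x x) (upair x y).

Lemma in_upair x y z : E z (upair x y) <-> z = x \/ z = y.
Proof. unfold upair; rewrite !in_adj; pose proof (in_emp z); tauto. Qed.

Lemma succ_neq_emp x : succ x <> emp.
Proof. intros H; apply (in_emp x); rewrite <- H; apply in_adj; now right. Qed.

Lemma succ_inj x y : succ x = succ y -> x = y.
Proof.
  intros H.
  assert (Hx : E x (succ y)) by (rewrite <- H; apply in_adj; now right).
  assert (Hy : E y (succ x)) by (rewrite H; apply in_adj; now right).
  apply in_adj in Hx as [Hx|]; trivial; apply in_adj in Hy as [Hy|]; auto.
  now apply D_no_cycle in Hx.
Qed.

Lemma upair_inj_r x y z : upair x y = upair x z -> y = z.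
Proof.
  intros H.
  assert (Hy : E y (upair x z)) by (rewrite <- H; apply in_upair; now right).
  assert (Hz : E z (upair x y)) by (rewrite H; apply in_upair; now right).
  apply in_upair in Hy; apply in_upair in Hz; destruct Hy, Hz; congruence.
Qed.

Lemma opair_inj x y x' y' : opair x y = opair x' y' -> x = x' /\ y = y'.
Proof.
  intros H.
  assert (Hx : x = x').
  { assert (H1 : E (upair x x) (opair x' y')) by (rewrite <- H; apply in_upair; now left).
    assert (H2 : E x' (upair x x)).
    { apply in_upair in H1 as [->| ->]; apply in_upair; now left. }
    apply in_upair in H2; intuition. }
  subst x'; split; trivial.
  apply upair_inj_r in H; now apply upair_inj_r in H.
Qed.

Definition Num (x : D) : Prop :=
  forall w, E emp w -> (forall u, E u w -> E (succ u) w) -> E x w.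

Lemma Num_emp : Num emp.
Proof. intros w H _; exact H. Qed.

Lemma Num_succ x : Num x -> Num (succ x).
Proof. intros Hx w H0 HS; apply HS, Hx; trivial. Qed.

Lemma omega_ex : exists w, E emp w /\ forall u, E u w -> E (succ u) w.
Proof.
  destruct D_inf as [w [[u [Hu Hemp]] HS]]; exists w; split.
  - replace emp with u; trivial; apply D_ext; intros z.
    pose proof (in_emp z); pose proof (Hemp z); tauto.
  - intros v Hv; destruct (HS v Hv) as [v' [Hv' Heq]].
    replace (succ v) with v'; trivial; apply D_ext; intros z.
    unfold succ; rewrite in_adj; apply Heq.
Qed.

Lemma Num_comprehension A rho : exists X, forall n, Num n -> (E n X <-> sat E (n .: rho) A).
Proof.
  destruct omega_ex as [w [H0 HS]], (D_sep A rho w) as [X HX]; exists X.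
  intros n Hn; rewrite HX; split; [tauto | split; trivial; now apply Hn].
Qed.

Lemma sat_fEmpty rho x : sat E rho (fEmpty x) <-> rho x = emp.
Proof.
  simpl; split.
  - intros H; apply D_ext; intros z; pose proof (in_emp z); pose proof (H z); tauto.
  - intros ->; exact in_emp.
Qed.

Lemma sat_fSucc rho x y : sat E rho (fSucc x y) <-> rho y = succ (rho x).
Proof.
  simpl; split.
  - intros H; apply D_ext; intros z; unfold succ; rewrite in_adj; apply H.
  - intros -> z; apply in_adj.
Qed.

Lemma sat_fUpair rho x y z : sat E rho (fUpair x y z) <-> rho z = upair (rho x) (rho y).
Proof.
  simpl; split.
  - intros H; apply D_ext; intros w; rewrite in_upair; apply H.
  - intros -> w; apply in_upair.
Qed.

Lemma sat_fPair rho x y z : sat E rho (fPair x y z) <-> rho z = opair (rho x) (rho y).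
Proof.
  unfold fPair; cbn [sat]; setoid_rewrite sat_fUpair; simpl; split.
  - intros [a [b [-> [-> H]]]]; exact H.
  - intros H; eauto.
Qed.

Lemma sat_fPairIn rho x y f :
  sat E rho (fPairIn x y f) <-> E (opair (rho x) (rho y)) (rho f).
Proof.
  unfold fPairIn; cbn [sat]; setoid_rewrite sat_fPair; simpl; split.
  - intros [c [Hc ->]]; exact Hc.
  - intros H; eauto.
Qed.

Lemma sat_fNum rho x : sat E rho (fNum x) <-> Num (rho x).
Proof.
  unfold fNum, SAllIn; cbn [sat]; setoid_rewrite sat_fEmpty; setoid_rewrite sat_fSucc.
  simpl; split; intros H w.
  - intros H0 HS; apply H; split; eauto.
  - intros [[e [-> H0]] HS]; apply H; trivial.
    intros u Hu; destruct (HS u Hu) as [v [-> Hv]]; exact Hv.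
Qed.

Lemma Num_ind A rho : sat E (emp .: rho) A ->
  (forall n, Num n -> sat E (n .: rho) A -> sat E (succ n .: rho) A) ->
  forall n, Num n -> sat E (n .: rho) A.
Proof.
  intros H0 HS; destruct omega_ex as [w [Hw0 HwS]].
  destruct (D_sep (fNum 0 ∧ A)%sf rho w) as [X HX]; cbn [sat] in HX; setoid_rewrite sat_fNum in HX.
  intros n Hn; apply HX, Hn.
  - apply HX; repeat split; trivial; apply Num_emp.
  - intros u Hu; apply HX in Hu as [Hu [HNu HAu]]; apply HX; repeat split; auto; now apply Num_succ.
Qed.

Lemma Num_ind_set X :
  E emp X -> (forall n, Num n -> E n X -> E (succ n) X) -> forall n, Num n -> E n X.
Proof. exact (Num_ind (0 ∈ 1)%sf (fun _ => X)). Qed.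

Definition Iter (H : D -> D -> Prop) (a n y : D) : Prop :=
  exists f, E (opair n y) f /\ forall i j, E (opair i j) f ->
    (i = emp /\ j = a) \/
    exists i' j', i = succ i' /\ H j' j /\ E (opair i' j') f.

Lemma sat_fIter H (h : D -> D -> D -> Prop) rho p a n y :
  (forall e, sat E e H <-> h (e 0) (e 1) (e 2)) ->
  sat E rho (fIter H p a n y) <-> Iter (h (rho p)) (rho a) (rho n) (rho y).
Proof.
  intros HH; unfold fIter; cbn [sat].
  setoid_rewrite sat_sapp; setoid_rewrite HH.
  setoid_rewrite sat_fPairIn; setoid_rewrite sat_fEmpty; setoid_rewrite sat_fSucc.
  reflexivity.
Qed.

Lemma Iter_emp H a y : Iter H a emp y <-> y = a.
Proof.
  split.
  - intros [f [Hf Hs]]; destruct (Hs _ _ Hf) as [[_ ->]|[i' [j' [Hi _]]]]; trivial.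
    now symmetry in Hi; apply succ_neq_emp in Hi.
  - intros ->; exists (adj emp (opair emp a)); split; [apply in_adj; now right|].
    intros i j Hij; left; apply in_adj in Hij as [Hij|Hij]; [now apply in_emp in Hij|].
    now apply opair_inj in Hij.
Qed.

Lemma Iter_succ H a n y : Iter H a (succ n) y <-> exists y', Iter H a n y' /\ H y' y.
Proof.
  split.
  - intros [f [Hf Hs]]; destruct (Hs _ _ Hf) as [[Hn _]|[i' [j' [Hi [Hj Hf']]]]].
    + now apply succ_neq_emp in Hn.
    + apply succ_inj in Hi; subst i'; exists j'; split; trivial; now exists f.
  - intros [y' [[f [Hf Hs]] Hy]]; exists (adj f (opair (succ n) y)).
    split; [apply in_adj; now right|].
    intros i j Hij; apply in_adj in Hij as [Hij|Hij].
    + destruct (Hs _ _ Hij) as [|[i' [j' [Hi [Hj Hf']]]]]; [now left|].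
      right; exists i', j'; rewrite in_adj; auto.
    + apply opair_inj in Hij as [-> ->]; right; exists n, y'; rewrite in_adj; auto.
Qed.

Lemma Iter_total H (h : D -> D -> D -> Prop) d a :
  (forall e, sat E e H <-> h (e 0) (e 1) (e 2)) ->
  (forall j, Num j -> exists j', Num j' /\ forall z, h d j z <-> z = j') -> Num a ->
  forall n, Num n -> exists k, Num k /\ forall z, Iter (h d) a n z <-> z = k.
Proof.
  intros HH Hh Ha n Hn.
  pose proof (Num_ind (SEx (fNum 0 ∧ SAll (fIter H 3 4 2 0 ↔ 0 ≡ 1)))%sf (d .: fun _ => a)) as Hind.
  cbn [sat] in Hind; setoid_rewrite sat_fNum in Hind; setoid_rewrite (sat_fIter H h) in Hind; trivial.
  refine (Hind _ _ n Hn); simpl; clear n Hn Hind.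
  - exists a; split; trivial; intros z; exact (Iter_emp (h d) a z).
  - intros n Hn [k [Hk Hkn]]; destruct (Hh k Hk) as [k' [Hk' Hkk']]; exists k'; split; trivial.
    intros z; change (Iter (h d) a (succ n) z <-> z = k').
    rewrite Iter_succ, <- Hkk'; split; [|intros Hz; exists k; split; trivial; now apply Hkn].
    intros [y' [Hy' Hz]]; apply Hkn in Hy' as ->; exact Hz.
Qed.

Definition Add : D -> D -> D -> Prop := Iter (fun j j' => j' = succ j).
Definition Mul (m : D) : D -> D -> Prop := Iter (fun j j' => Add j m j') emp.

Lemma sat_fAdd rho : sat E rho fAdd <-> Add (rho 0) (rho 1) (rho 2).
Proof. apply (sat_fIter _ (fun _ j j' => j' = succ j)); intros e; apply sat_fSucc. Qed.

Lemma sat_fAdd_step e : sat E e (sapp fAdd [1; 0; 2]) <-> Add (e 1) (e 0) (e 2).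
Proof. rewrite sat_sapp, sat_fAdd; reflexivity. Qed.

Lemma sat_fMul rho : sat E rho fMul <-> Mul (rho 0) (rho 1) (rho 2).
Proof.
  unfold fMul; cbn [sat]; setoid_rewrite sat_fEmpty.
  setoid_rewrite (sat_fIter _ (fun d j j' => Add j d j')); [|exact sat_fAdd_step].
  simpl; split; [intros [z [-> H]]; exact H | intros H; exists emp; now split].
Qed.

Definition num : Type := {x : D | Num x}.

Lemma num_eq (m n : num) : proj1_sig m = proj1_sig n -> m = n.
Proof. intros H; apply eq_sig_hprop; trivial; intros; apply proof_irrelevance. Qed.

Definition num_zero : num := exist _ emp Num_emp.
Definition num_succ (n : num) : num := exist _ (succ (proj1_sig n)) (Num_succ _ (proj2_sig n)).

Lemma Add_total (m n : num) :
  exists k : num, forall z, Add (proj1_sig m) (proj1_sig n) z <-> z = proj1_sig k.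
Proof.
  destruct m as [m Hm], n as [n Hn]; simpl.
  destruct (Iter_total (fSucc 1 2) (fun _ j j' => j' = succ j) emp m) with n
    as [k [Hk Hkz]]; trivial.
  - intros e; apply sat_fSucc.
  - intros j Hj; exists (succ j); split; [now apply Num_succ | reflexivity].
  - now exists (exist _ k Hk).
Qed.

Definition num_add (m n : num) : num :=
  epsilon (inhabits num_zero) (fun k => forall z, Add (proj1_sig m) (proj1_sig n) z <-> z = proj1_sig k).

Lemma Add_num (m n : num) z : Add (proj1_sig m) (proj1_sig n) z <-> z = proj1_sig (num_add m n).
Proof.
  revert z; unfold num_add.
  apply (epsilon_spec (inhabits num_zero)
    (fun k : num => forall z, Add (proj1_sig m) (proj1_sig n) z <-> z = proj1_sig k)), Add_total.
Qed.

Lemma Mul_total (m n : num) :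
  exists k : num, forall z, Mul (proj1_sig m) (proj1_sig n) z <-> z = proj1_sig k.
Proof.
  destruct n as [n Hn]; simpl.
  destruct (Iter_total (sapp fAdd [1; 0; 2]) (fun d j j' => Add j d j') (proj1_sig m) emp) with n
    as [k [Hk Hkz]]; trivial.
  - exact sat_fAdd_step.
  - intros j Hj; exists (proj1_sig (num_add (exist _ j Hj) m)); split; [apply proj2_sig|].
    exact (Add_num (exist _ j Hj) m).
  - exact Num_emp.
  - now exists (exist _ k Hk).
Qed.

Definition num_mul (m n : num) : num :=
  epsilon (inhabits num_zero) (fun k => forall z, Mul (proj1_sig m) (proj1_sig n) z <-> z = proj1_sig k).

Lemma Mul_num (m n : num) z : Mul (proj1_sig m) (proj1_sig n) z <-> z = proj1_sig (num_mul m n).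
Proof.
  revert z; unfold num_mul.
  apply (epsilon_spec (inhabits num_zero)
    (fun k : num => forall z, Mul (proj1_sig m) (proj1_sig n) z <-> z = proj1_sig k)), Mul_total.
Qed.

Lemma num_add_zero m : num_add m num_zero = m.
Proof. symmetry; apply num_eq, Add_num, Iter_emp; reflexivity. Qed.

Lemma num_add_succ m n : num_add m (num_succ n) = num_succ (num_add m n).
Proof.
  symmetry; apply num_eq, Add_num, Iter_succ.
  exists (proj1_sig (num_add m n)); split; [now apply Add_num | reflexivity].
Qed.

Lemma num_mul_zero m : num_mul m num_zero = num_zero.
Proof. symmetry; apply num_eq, Mul_num, Iter_emp; reflexivity. Qed.

Lemma num_mul_succ m n : num_mul m (num_succ n) = num_add (num_mul m n) m.
Proof.
  symmetry; apply num_eq, Mul_num, Iter_succ.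
  exists (proj1_sig (num_mul m n)); split; [now apply Mul_num | now apply Add_num].
Qed.

Local Notation eval := (teval num num_zero num_succ num_add num_mul).
Local Notation holds :=
  (asat num D num_zero num_succ num_add num_mul (fun n X => E (proj1_sig n) X)).

Lemma sat_num rho xs : sat E rho (sapp (i_num PA2_in_sets) xs) <-> Num (rho (nth 0 xs 0)).
Proof. rewrite sat_sapp; exact (sat_fNum _ 0). Qed.

Lemma sat_zero rho xs : sat E rho (sapp (i_zero PA2_in_sets) xs) <-> rho (nth 0 xs 0) = emp.
Proof. rewrite sat_sapp; exact (sat_fEmpty _ 0). Qed.

Lemma sat_succ rho xs :
  sat E rho (sapp (i_succ PA2_in_sets) xs) <-> rho (nth 1 xs 0) = succ (rho (nth 0 xs 0)).
Proof. rewrite sat_sapp; exact (sat_fSucc _ 0 1). Qed.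

Lemma sat_add rho xs : sat E rho (sapp (i_add PA2_in_sets) xs) <->
  Add (rho (nth 0 xs 0)) (rho (nth 1 xs 0)) (rho (nth 2 xs 0)).
Proof. rewrite sat_sapp; exact (sat_fAdd _). Qed.

Lemma sat_mul rho xs : sat E rho (sapp (i_mul PA2_in_sets) xs) <->
  Mul (rho (nth 0 xs 0)) (rho (nth 1 xs 0)) (rho (nth 2 xs 0)).
Proof. rewrite sat_sapp; exact (sat_fMul _). Qed.

Lemma sat_all_num rho A (P : num -> Prop) :
  (forall n, sat E (proj1_sig n .: rho) A <-> P n) ->
  sat E rho (SAllNum PA2_in_sets A) <-> forall n, P n.
Proof.
  intros H; unfold SAllNum; cbn [sat]; setoid_rewrite sat_num; split.
  - intros HA n; apply H, HA, (proj2_sig n).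
  - intros HA d Hd; exact (proj2 (H (exist _ d Hd)) (HA _)).
Qed.

Lemma sat_ex_num rho A (P : num -> Prop) :
  (forall n, sat E (proj1_sig n .: rho) A <-> P n) ->
  sat E rho (SExNum PA2_in_sets A) <-> exists n, P n.
Proof.
  intros H; unfold SExNum; cbn [sat]; setoid_rewrite sat_num; split.
  - intros [d [Hd HA]]; exists (exist _ d Hd); now apply H.
  - intros [n Hn]; exists (proj1_sig n); split; [exact (proj2_sig n) | now apply H].
Qed.

Lemma tr_term_sat t : forall rho r y e, (forall n, rho (r n) = proj1_sig (e n)) ->
  sat E rho (tr_term PA2_in_sets r t y) <-> rho y = proj1_sig (eval e t).
Proof.
  induction t; cbn [tr_term teval]; intros rho r y e He.
  - simpl; rewrite He; split; congruence.
  - apply sat_zero.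
  - rewrite (sat_ex_num _ _ (fun a => a = eval e t /\ rho y = succ (proj1_sig a))).
    + split; [intros [a [-> H]]; exact H | eauto].
    + intros a; cbn [sat]; rewrite (IHt _ _ _ e) by exact He; rewrite sat_succ.
      apply and_iff_compat_r; split; [apply num_eq | now intros ->].
  - rewrite (sat_ex_num _ _ (fun a => exists b, a = eval e t1 /\ b = eval e t2 /\
                                  rho y = proj1_sig (num_add a b))).
    + split; [intros [a [b [-> [-> H]]]]; exact H | intros H; repeat eexists; exact H].
    + intros a; apply sat_ex_num; intros b; cbn [sat].
      rewrite (IHt1 _ _ _ e), (IHt2 _ _ _ e) by exact He; rewrite sat_add; cbn.
      rewrite Add_num;
      repeat split; try tauto; try apply num_eq; try apply H;
        destruct H as [-> [-> _]]; reflexivity.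
  - rewrite (sat_ex_num _ _ (fun a => exists b, a = eval e t1 /\ b = eval e t2 /\
                                  rho y = proj1_sig (num_mul a b))).
    + split; [intros [a [b [-> [-> H]]]]; exact H | intros H; repeat eexists; exact H].
    + intros a; apply sat_ex_num; intros b; cbn [sat].
      rewrite (IHt1 _ _ _ e), (IHt2 _ _ _ e) by exact He; rewrite sat_mul; cbn.
      rewrite Mul_num;
      repeat split; try tauto; try apply num_eq; try apply H;
        destruct H as [-> [-> _]]; reflexivity.
Qed.

Lemma tr_form_sat A : forall rho r q e v,
  (forall n, rho (r n) = proj1_sig (e n)) -> (forall X, rho (q X) = v X) ->
  sat E rho (tr_form PA2_in_sets r q A) <-> holds e v A.
Proof.
  assert (Hset : forall rho B (P : D -> Prop), (forall X, sat E (X .: rho) B <-> P X) ->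
    (sat E rho (SAllSet PA2_in_sets B) <-> forall X, P X) /\
    (sat E rho (SExSet PA2_in_sets B) <-> exists X, P X)).
  { intros rho B P HB; unfold SAllSet, SExSet; cbn; setoid_rewrite HB.
    split; split; [intros H X; now apply H | auto | intros [X [_ H]]; eauto | ].
    intros [X H]; eauto. }
  induction A; cbn [tr_form asat]; intros rho r q e v He Hv.
  - reflexivity.
  - rewrite (sat_ex_num _ _ (fun a => a = eval e t /\ a = eval e t0)).
    + split; [intros [a [-> H]]; exact H | eauto].
    + intros a; cbn [sat]; rewrite !(tr_term_sat _ _ _ _ e) by exact He; cbn.
      split; intros [H1 H2]; split; try apply num_eq; trivial; now f_equal.
  - rewrite (sat_ex_num _ _ (fun a => a = eval e t /\ E (proj1_sig a) (v n))).
    + split; [intros [a [-> H]]; exact H | eauto].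
    + intros a; cbn [sat]; rewrite (tr_term_sat _ _ _ _ e) by exact He; cbn; rewrite Hv.
      apply and_iff_compat_r; split; [apply num_eq | now intros ->].
  - cbn [sat]; rewrite (IHA1 rho r q e v), (IHA2 rho r q e v); tauto.
  - cbn [sat]; rewrite (IHA1 rho r q e v), (IHA2 rho r q e v); tauto.
  - cbn [sat]; rewrite (IHA1 rho r q e v), (IHA2 rho r q e v); tauto.
  - apply sat_all_num; intros n; apply IHA; [now intros [|k]; simpl | exact Hv].
  - apply sat_ex_num; intros n; apply IHA; [now intros [|k]; simpl | exact Hv].
  - apply Hset; intros X; apply IHA; [exact He | now intros [|k]; simpl].
  - apply Hset; intros X; apply IHA; [exact He | now intros [|k]; simpl].
Qed.

(* The assignments of number and set variables are interleaved into one. *)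
Lemma holds_comprehension A e v : exists X, forall n : num, E (proj1_sig n) X <-> holds (n .: e) v A.
Proof.
  destruct (Num_comprehension
    (tr_form PA2_in_sets (0 .: fun n => S (2 * n)) (fun X => S (S (2 * X))) A)
    (fun k => if Nat.even k then proj1_sig (e (Nat.div2 k)) else v (Nat.div2 k))) as [X HX].
  exists X; intros n; rewrite (HX _ (proj2_sig n)); apply tr_form_sat.
  - intros [|k]; cbn [scons]; trivial.
    now rewrite Nat.even_even, Nat.div2_double.
  - intros k; cbn [scons].
    rewrite Nat.even_succ, Nat.odd_even, Nat.div2_succ_double; reflexivity.
Qed.

Lemma PA2_holds A e v : PA2 A -> holds e v A.
Proof.
  intros []; simpl.
  - intros n H; apply (f_equal (@proj1_sig _ _)) in H; exact (succ_neq_emp _ H).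
  - intros m n H; apply num_eq, succ_inj, (f_equal (@proj1_sig _ _) H).
  - apply num_add_zero.
  - apply num_add_succ.
  - apply num_mul_zero.
  - apply num_mul_succ.
  - intros X [H0 HS] [n Hn]; apply Num_ind_set; trivial.
    intros m Hm; exact (HS (exist _ m Hm)).
  - destruct (holds_comprehension A0 e v) as [X HX]; exists X; intros n.
    pose proof (asat_ashift2 _ _ num_zero num_succ num_add num_mul
      (fun n X => E (proj1_sig n) X) A0 (n .: e) v X) as Hs.
    pose proof (HX n); tauto.
Qed.

Lemma sat_all_num_intro rho A :
  (forall n : num, sat E (proj1_sig n .: rho) A) -> sat E rho (SAllNum PA2_in_sets A).
Proof. apply (sat_all_num rho A _ (fun n => iff_refl _)). Qed.

Lemma sat_ex_unique_num rho A : (exists k : num, forall d, sat E (d .: rho) A <-> d = proj1_sig k) ->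
  sat E rho (SExUniqueNum PA2_in_sets A).
Proof.
  intros [k Hk]; apply (sat_ex_num rho _ _ (fun n => iff_refl _)); exists k; cbn [sat].
  split; [now apply Hk|].
  apply sat_all_num_intro; intros n Hn; apply (Hk (proj1_sig n)).
  refine (proj1 (sat_sren _ A _ _ _ _) Hn); now intros [|m].
Qed.

Lemma translate_sat A rho : sentence A -> aprv PA2 [] A -> sat E rho (translate PA2_in_sets A).
Proof.
  intros HA HP.
  apply (sat_closed _ _ (fun _ => emp)); [now apply translate_closed|].
  apply (tr_form_sat _ _ _ _ (fun _ => num_zero) (fun _ => emp)); trivial.
  apply (aprv_sound _ _ _ _ _ _ _ PA2 [] A); trivial; [|intros B []].
  intros B e v; apply PA2_holds.
Qed.

End Model.

Theorem corollary5p10 : interpretable_in PA2 CZF_LEM.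
Proof.
  exists PA2_in_sets.
  assert (HT : forall B, CZF_LEM (SOr B (SImp B SBot))) by (intros B; right; constructor).
  split; [..|intros A HA HP]; apply completeness; trivial; intros D E HD rho;
    pose proof (rho 0) as d0.
  - exists (emp D E d0); exact (proj2 (sat_fNum D E HD d0 _ 0) (Num_emp D E d0)).
  - now exists d0.
  - apply (sat_ex_unique_num D E HD d0); exists (num_zero D E d0); intros d.
    apply (sat_zero D E HD d0).
  - apply (sat_all_num_intro D E HD d0); intros n.
    apply (sat_ex_unique_num D E HD d0); exists (num_succ D E d0 n); intros d.
    apply (sat_succ D E HD d0).
  - apply (sat_all_num_intro D E HD d0); intros k; apply (sat_all_num_intro D E HD d0); intros n.
    apply (sat_ex_unique_num D E HD d0); exists (num_add D E d0 k n); intros d.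
    rewrite (sat_add D E HD d0); apply (Add_num D E HD d0).
  - apply (sat_all_num_intro D E HD d0); intros k; apply (sat_all_num_intro D E HD d0); intros n.
    apply (sat_ex_unique_num D E HD d0); exists (num_mul D E d0 k n); intros d.
    rewrite (sat_mul D E HD d0); apply (Mul_num D E HD d0).
  - now apply (translate_sat D E HD d0).
Qed.
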